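(* Let $\varepsilon \in (0,1)$. If $\mathcal{L} = \langle [0,1], \leq, \land, \lor, \otimes, \to, 0, 1\rangle$ is the product structure or the Hamacher structure, then the approximation $\mathcal{L}_\varepsilon$ of $\mathcal{L}$ is $\otimes$-locally finite.
   Context: The product structure and the Hamacher structure are the unit interval $[0,1]$ with the usual order and with multiplication $\otimes$, respectively: $x \otimes_P y = xy$; and $x \otimes_H y = \frac{xy}{x+y-xy}$ if $x \neq 0$ or $y \neq 0$, $x\otimes_H y = 0$ otherwise. (The residua are $x\to y = 1$ if $x \leq y$, and otherwise $y/x$ for the product structure and $\frac{xy}{x-y+xy}$ for the Hamacher structure.) For $\varepsilon \in [0,1]$, the multiplication of $\mathcal{L}_\varepsilon$ is $x \otimes_\varepsilon y = x \otimes y$ if $x \otimes y > \varepsilon$, and $x \otimes_\varepsilon y = \varepsilon$ otherwise; it is an associative and commutative operation on $[0,1]$. $\mathcal{L}_\varepsilon$ is called $\otimes$-locally finite if, for every finite set $A \subseteq [0,1]$, the smallest subset of $[0,1]$ that contains $A \cup \{1\}$ and is closed under $\otimes_\varepsilon$ is finite. *)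

(* Defs.v *)
From mathcomp Require Import all_boot all_order all_algebra.
From mathcomp Require Import ring lra.
From mathcomp Require Import mathcomp_extra boolp classical_sets cardinality.
From mathcomp Require Import set_interval reals.

Set Implicit Arguments.
Unset Strict Implicit.
Unset Printing Implicit Defensive.

Import Order.TTheory GRing.Theory Num.Theory.

Local Open Scope classical_set_scope.
Local Open Scope ring_scope.

(* Residuated lattice on [0,1] with the usual order, the bounds 0 and 1, and
   min and max as lattice operations.  The operations are total on R; only
   their values on [0,1] are meaningful. *)
Record unit_residuated_lattice (R : realType) := UnitResiduatedLattice {
  rl_mul : R -> R -> R;
  rl_res : R -> R -> R;
  rl_mul_itv : forall x y, 0 <= x <= 1 -> 0 <= y <= 1 ->
    0 <= rl_mul x y <= 1;
  rl_res_itv : forall x y, 0 <= x <= 1 -> 0 <= y <= 1 ->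
    0 <= rl_res x y <= 1;
  rl_mulC : forall x y, 0 <= x <= 1 -> 0 <= y <= 1 ->
    rl_mul x y = rl_mul y x;
  rl_mulA : forall x y z, 0 <= x <= 1 -> 0 <= y <= 1 -> 0 <= z <= 1 ->
    rl_mul x (rl_mul y z) = rl_mul (rl_mul x y) z;
  rl_mul1 : forall x, 0 <= x <= 1 -> rl_mul x 1 = x;
  rl_adj : forall x y z, 0 <= x <= 1 -> 0 <= y <= 1 -> 0 <= z <= 1 ->
    (rl_mul x y <= z) = (x <= rl_res y z)
}.

Section Structures.
Variable R : realType.
Implicit Types x y z : R.

Definition product_mul x y := x * y.

Definition product_res x y := if x <= y then 1 else y / x.

Definition hamacher_mul x y :=
  if (x != 0) || (y != 0) then x * y / (x + y - x * y) else 0.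

Definition hamacher_res x y :=
  if x <= y then 1 else x * y / (x - y + x * y).

Lemma product_mul_itv x y : 0 <= x <= 1 -> 0 <= y <= 1 ->
  0 <= product_mul x y <= 1.
Proof.
move=> /andP[x0 x1] /andP[y0 y1]; rewrite /product_mul mulr_ge0 //=.
by rewrite mulr_ile1.
Qed.

Lemma product_res_itv x y : 0 <= x <= 1 -> 0 <= y <= 1 ->
  0 <= product_res x y <= 1.
Proof.
move=> /andP[x0 x1] /andP[y0 y1]; rewrite /product_res.
case: (leP x y) => [_|yx]; first by rewrite ler01 lexx.
have x_gt0 := le_lt_trans y0 yx.
by rewrite divr_ge0 //= ler_pdivrMr // mul1r ltW.
Qed.

Lemma product_adj x y z : 0 <= x <= 1 -> 0 <= y <= 1 -> 0 <= z <= 1 ->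
  (product_mul x y <= z) = (x <= product_res y z).
Proof.
move=> /andP[x0 x1] /andP[y0 y1] /andP[z0 z1].
rewrite /product_mul /product_res; case: (leP y z) => [yz|zy].
  by rewrite x1; apply: le_trans yz; rewrite ler_piMl.
by rewrite ler_pdivlMr // (le_lt_trans z0 zy).
Qed.

Definition product_structure : unit_residuated_lattice R :=
  @UnitResiduatedLattice R product_mul product_res
    product_mul_itv product_res_itv
    (fun x y _ _ => mulrC x y) (fun x y z _ _ _ => mulrA x y z)
    (fun x _ => mulr1 x) product_adj.

Lemma hamacher_mul0 y : hamacher_mul 0 y = 0.
Proof. by rewrite /hamacher_mul mul0r mul0r if_same. Qed.

Lemma hamacher_mulx0 x : hamacher_mul x 0 = 0.
Proof. by rewrite /hamacher_mul mulr0 mul0r if_same. Qed.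

Lemma hamacher_den_gt0 x y : 0 < x -> 0 <= y <= 1 -> 0 < x + y - x * y.
Proof.
move=> x0 /andP[y0 y1]; have [->|yn1] := eqVneq y 1; first by lra.
have ylt1 : y < 1 by rewrite lt_neqAle yn1.
by nra.
Qed.

Lemma hamacher_mulE x y : 0 < x -> 0 <= y <= 1 ->
  0 < x + y - x * y /\ hamacher_mul x y = x * y / (x + y - x * y).
Proof.
move=> x0 y01; split; first exact: hamacher_den_gt0.
by rewrite /hamacher_mul gt_eqF.
Qed.

Lemma hamacher_mul_gt0 x y : 0 < x -> 0 < y <= 1 -> 0 < hamacher_mul x y.
Proof.
move=> x0 /andP[y0 y1].
have [|d0 ->] := @hamacher_mulE x y x0; first by rewrite ltW.
by rewrite divr_gt0 // mulr_gt0.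
Qed.

Lemma hamacher_mul_itv x y : 0 <= x <= 1 -> 0 <= y <= 1 ->
  0 <= hamacher_mul x y <= 1.
Proof.
move=> /andP[]; rewrite le_eqVlt => /predU1P[<- _ _|x0 x1 y01].
  by rewrite hamacher_mul0 lexx ler01.
have [d0 ->] := hamacher_mulE x0 y01; case/andP: y01 => y0 y1.
rewrite divr_ge0 ?mulr_ge0 ?(ltW d0) ?(ltW x0) //= ler_pdivrMr // mul1r; nra.
Qed.

Lemma hamacher_res_den_gt0 x y : 0 <= y -> y < x -> 0 < x - y + x * y.
Proof. by move=> y0 yx; nra. Qed.

Lemma hamacher_res_itv x y : 0 <= x <= 1 -> 0 <= y <= 1 ->
  0 <= hamacher_res x y <= 1.
Proof.
move=> /andP[x0 x1] /andP[y0 y1]; rewrite /hamacher_res.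
case: (leP x y) => [_|yx]; first by rewrite ler01 lexx.
have d0 := hamacher_res_den_gt0 y0 yx.
rewrite divr_ge0 ?mulr_ge0 ?(ltW d0) //= ler_pdivrMr // mul1r; lra.
Qed.

Lemma hamacher_mulC x y : hamacher_mul x y = hamacher_mul y x.
Proof. by rewrite /hamacher_mul orbC [x * y]mulrC [x + y]addrC. Qed.

Lemma hamacher_mulA x y z : 0 <= x <= 1 -> 0 <= y <= 1 -> 0 <= z <= 1 ->
  hamacher_mul x (hamacher_mul y z) = hamacher_mul (hamacher_mul x y) z.
Proof.
move=> x01 y01 z01.
have [->|xn0] := eqVneq x 0; first by rewrite !hamacher_mul0.
have [->|yn0] := eqVneq y 0; first by rewrite hamacher_mulx0 !hamacher_mul0 hamacher_mulx0.
have [->|zn0] := eqVneq z 0; first by rewrite !hamacher_mulx0.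
have x0 : 0 < x by rewrite lt_neqAle eq_sym xn0; case/andP: x01.
have y0 : 0 < y by rewrite lt_neqAle eq_sym yn0; case/andP: y01.
have yz01 := hamacher_mul_itv y01 z01.
have xy01 := hamacher_mul_itv x01 y01.
have xy0 : 0 < hamacher_mul x y.
  by apply: hamacher_mul_gt0 => //; rewrite y0; case/andP: y01.
have [+ ->] := hamacher_mulE x0 yz01.
have [+ ->] := hamacher_mulE xy0 z01.
have [d1 ->] := hamacher_mulE x0 y01.
have [d2 ->] := hamacher_mulE y0 z01.
have -> : x * y / (x + y - x * y) + z - x * y / (x + y - x * y) * z =
  (x * y + z * (x + y - x * y) - x * y * z) / (x + y - x * y).
  by field; rewrite gt_eqF.
have -> : x + y * z / (y + z - y * z) - x * (y * z / (y + z - y * z)) =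
  (x * (y + z - y * z) + y * z - x * y * z) / (y + z - y * z).
  by field; rewrite gt_eqF.
rewrite !pmulr_lgt0 ?invr_gt0 // => d3 d4.
by field; rewrite !gt_eqF.
Qed.

Lemma hamacher_mul1 x : 0 <= x <= 1 -> hamacher_mul x 1 = x.
Proof.
move=> _; rewrite /hamacher_mul oner_neq0 orbT !mulr1.
by rewrite addrAC subrr add0r divr1.
Qed.

Lemma hamacher_adj x y z : 0 <= x <= 1 -> 0 <= y <= 1 -> 0 <= z <= 1 ->
  (hamacher_mul x y <= z) = (x <= hamacher_res y z).
Proof.
move=> x01 y01 /andP[z0 z1]; case/andP: (y01) => y0 y1.
case/andP: (x01); rewrite le_eqVlt => /predU1P[<- _|x0 x1].
  rewrite hamacher_mul0 z0; have /andP[r0 _] : 0 <= hamacher_res y z <= 1.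
    by apply: hamacher_res_itv => //; rewrite z0.
  by rewrite r0.
have [d0 ->] := hamacher_mulE x0 y01.
rewrite ler_pdivrMr // /hamacher_res; case: (leP y z) => [yz|zy].
  rewrite x1; apply: le_trans (_ : y * (x + y - x * y) <= _); first by nra.
  by rewrite ler_wpM2r // ltW.
rewrite ler_pdivlMr ?hamacher_res_den_gt0 //.
by apply/idP/idP => ?; lra.
Qed.

Definition hamacher_structure : unit_residuated_lattice R :=
  @UnitResiduatedLattice R hamacher_mul hamacher_res
    hamacher_mul_itv hamacher_res_itv
    (fun x y _ _ => hamacher_mulC x y) hamacher_mulA
    hamacher_mul1 hamacher_adj.

Definition approx_mul (L : unit_residuated_lattice R) (eps x y : R) : R :=
  if rl_mul L x y > eps then rl_mul L x y else eps.

Definition closed_under (op : R -> R -> R) (B : set R) : Prop :=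
  forall x y, B x -> B y -> B (op x y).

(* Subsets of [0,1] closed under op.  When op does not preserve [0,1] there may
   be none above A, and then mul_closure op A is all of R; approx_mul_itv
   excludes this case for approx_mul. *)
Definition mul_closure (op : R -> R -> R) (A : set R) : set R :=
  smallest [set B | B `<=` `[0, 1] /\ closed_under op B] (A `|` [set 1]).

Definition mul_locally_finite (op : R -> R -> R) : Prop :=
  forall A : set R, A `<=` `[0, 1] -> finite_set A ->
    finite_set (mul_closure op A).

Lemma approx_mul_itv (L : unit_residuated_lattice R) (eps x y : R) :
  0 <= eps <= 1 -> 0 <= x <= 1 -> 0 <= y <= 1 ->
  0 <= approx_mul L eps x y <= 1.
Proof.
move=> e01 x01 y01; rewrite /approx_mul; case: ifP => // _.
exact: rl_mul_itv.
Qed.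

End Structures.

(* Main.v *)
(** The arithmetic behind both cases is that each multiplication lies below the
    Hamacher one, x ⊗ y <= xy / (x + y - xy).  Since the n-th Hamacher power of
    a is a / (a + n (1 - a)), all large powers of any a < 1 drop below eps.
    A product of elements of a finite set A that stays above eps therefore uses
    each a <> 1 of A boundedly often, so there are finitely many such products;
    together with A and eps they form a set closed under the truncated
    multiplication. *)
Require Import Defs.
From mathcomp Require Import all_boot all_order all_algebra.
From mathcomp Require Import lra.
From mathcomp Require Import classical_sets cardinality reals.

Import Order.TTheory GRing.Theory Num.Theory.
Local Open Scope classical_set_scope.
Local Open Scope ring_scope.

Section ResiduatedLattice.
Set Implicit Arguments.
Unset Strict Implicit.
Context {R : realType} (L : unit_residuated_lattice R).
Implicit Types (x y z a : R) (s : seq R).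

Lemma unit_itv1 : 0 <= (1 : R) <= 1.
Proof. by rewrite ler01 lexx. Qed.

(** Residuation alone gives monotonicity: the adjunction turns the goal into
    [x <= rl_res L z (rl_mul L y z)], and [y] already lies below that residuum. *)
Lemma rl_mul_ler x y z : 0 <= x <= 1 -> 0 <= y <= 1 -> 0 <= z <= 1 ->
  x <= y -> rl_mul L x z <= rl_mul L y z.
Proof.
move=> x01 y01 z01 xy.
have yz01 := rl_mul_itv L y01 z01.
by rewrite rl_adj // (le_trans xy) // -rl_adj.
Qed.

Lemma rl_mul_leQr x y : 0 <= x <= 1 -> 0 <= y <= 1 -> rl_mul L x y <= y.
Proof.
move=> x01 y01; apply: le_trans (rl_mul_ler x01 unit_itv1 y01 _) _.
  by case/andP: x01.
by rewrite rl_mulC ?unit_itv1 // rl_mul1.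
Qed.

Lemma rl_mul_leQl x y : 0 <= x <= 1 -> 0 <= y <= 1 -> rl_mul L x y <= x.
Proof. by move=> x01 y01; rewrite rl_mulC // rl_mul_leQr. Qed.

Definition rl_exp a n := iter n (rl_mul L a) 1.

Lemma rl_exp_itv a n : 0 <= a <= 1 -> 0 <= rl_exp a n <= 1.
Proof.
by move=> a01; elim: n => [|n IHn]; [exact: unit_itv1 | exact: rl_mul_itv].
Qed.

Lemma rl_expD a m n : 0 <= a <= 1 ->
  rl_exp a (m + n) = rl_mul L (rl_exp a m) (rl_exp a n).
Proof.
move=> a01; have e01 k := rl_exp_itv k a01.
elim: m => [|m IHm]; first by rewrite rl_mulC ?unit_itv1 // rl_mul1.
by rewrite addSn /= -/(rl_exp a (m + n)) IHm rl_mulA.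
Qed.

Lemma rl_exp_le a m n : 0 <= a <= 1 -> (m <= n)%N -> rl_exp a n <= rl_exp a m.
Proof.
by move=> a01 /subnKC <-; rewrite rl_expD // rl_mul_leQl ?rl_exp_itv.
Qed.

Lemma rl_exp1 n : rl_exp 1 n = 1.
Proof. by elim: n => //= n ->; rewrite rl_mul1 ?unit_itv1. Qed.

(** The submonoid generated by [s], in a normal form with one exponent per list entry, so that
    bounding the exponents bounds the set. *)
Fixpoint rl_span s : set R :=
  if s is a :: s' then
    [set rl_mul L (rl_exp a k) y | k in setT & y in rl_span s']
  else [set 1].

Lemma rl_span_itv s x : {in s, forall a, 0 <= a <= 1} -> rl_span s x ->
  0 <= x <= 1.
Proof.
elim: s x => [|a s IHs] x s01 /=; first by move=> ->; exact: unit_itv1.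
move=> [k _ [y sy <-]]; apply: rl_mul_itv.
  by apply: rl_exp_itv; apply: s01; rewrite mem_head.
by apply: IHs => // b bs; apply: s01; rewrite inE bs orbT.
Qed.

Lemma rl_span1 s : rl_span s 1.
Proof.
elim: s => [//|a s IHs]; exists 0%N => //; exists 1 => //.
by rewrite rl_mul1 ?unit_itv1.
Qed.

Lemma mem_rl_span s a : {in s, forall b, 0 <= b <= 1} -> a \in s ->
  rl_span s a.
Proof.
elim: s => // b s IHs bs01; rewrite inE => /predU1P[->|as_].
  have b01 : 0 <= b <= 1 by apply: bs01; rewrite mem_head.
  exists 1%N => //; exists 1; first exact: rl_span1.
  by rewrite /rl_exp /= !rl_mul1.
have s01 : {in s, forall c, 0 <= c <= 1}.
  by move=> c cs; apply: bs01; rewrite inE cs orbT.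
exists 0%N => //; exists a; first exact: IHs.
by rewrite /= rl_mulC ?unit_itv1 ?s01 // rl_mul1 // s01.
Qed.

Lemma rl_span_closed s : {in s, forall a, 0 <= a <= 1} ->
  closed_under (rl_mul L) (rl_span s).
Proof.
elim: s => [_ x y -> ->|a s IHs as01 x y].
  by rewrite /= rl_mul1 ?unit_itv1.
have a01 : 0 <= a <= 1 by apply: as01; rewrite mem_head.
have s01 : {in s, forall c, 0 <= c <= 1}.
  by move=> c cs; apply: as01; rewrite inE cs orbT.
move=> [k _ [u su <-]] [l _ [v sv <-]].
exists (k + l)%N => //; exists (rl_mul L u v); first exact: IHs.
have u01 := rl_span_itv s01 su; have v01 := rl_span_itv s01 sv.
have k01 := rl_exp_itv k a01; have l01 := rl_exp_itv l a01.
rewrite rl_expD // -!rl_mulA ?rl_mul_itv //; congr (rl_mul L _ _).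
by rewrite !rl_mulA // (rl_mulC L u01).
Qed.

Definition rl_archimedean eps :=
  forall a, 0 <= a < 1 -> exists n, rl_exp a n <= eps.

(** A product lies below each of its factors. If it exceeds [eps], so does the cofactor of the power
    of [a], which the induction hypothesis covers, and so does that power, which bounds its
    exponent. *)
Lemma finite_rl_span_gt eps s : rl_archimedean eps ->
  {in s, forall a, 0 <= a <= 1} ->
  finite_set (rl_span s `&` [set x | eps < x]).
Proof.
move=> arch; elim: s => [_|a s IHs as01].
  by apply: sub_finite_set (finite_set1 (1 : R)) => x [].
have a01 : 0 <= a <= 1 by apply: as01; rewrite mem_head.
have s01 : {in s, forall c, 0 <= c <= 1}.
  by move=> c cs; apply: as01; rewrite inE cs orbT.
(* The powers of 1 never drop, but they are all 1, so this generator adds nothing to the span. *)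
have [a1|a_neq1] := eqVneq a 1.
  apply: sub_finite_set (IHs s01) => _ [[k _ [y sy <-]] /=].
  by rewrite a1 rl_exp1 rl_mulC ?rl_mul1 ?unit_itv1 ?(rl_span_itv s01 sy).
have [n an] : exists n, rl_exp a n <= eps.
  by apply: arch; case/andP: a01 => -> ale1; rewrite lt_neqAle a_neq1.
apply: sub_finite_set
  (finite_image2 (fun k => rl_mul L (rl_exp a k)) (finite_II n) (IHs s01)).
move=> _ [[k _ [y sy <-]] /= eps_lt].
have y01 := rl_span_itv s01 sy; have k01 := rl_exp_itv k a01.
exists k.
  rewrite /= ltnNge; apply/negP => nk.
  have := lt_le_trans eps_lt (rl_mul_leQl k01 y01).
  by rewrite ltNge (le_trans (rl_exp_le a01 nk)).
by exists y => //; split=> //=; exact: lt_le_trans (rl_mul_leQr k01 y01).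
Qed.

Lemma approx_mul_locally_finite eps : 0 <= eps < 1 -> rl_archimedean eps ->
  mul_locally_finite (approx_mul L eps).
Proof.
move=> /andP[eps0 eps1] arch A A01 /finite_seqP[s As].
have s01 : {in s, forall a, 0 <= a <= 1}.
  by move=> a as_; have /A01 : A a; rewrite ?As //= in_itv.
(* [A] is added for its elements at or below [eps], and [eps] as the truncation value. *)
pose B := (rl_span s `&` [set x | eps < x]) `|` (A `|` [set eps]).
have B01 x : B x -> 0 <= x <= 1.
  case=> [[/(rl_span_itv s01)//]|[/A01|->]]; first by rewrite /= in_itv.
  by rewrite eps0 ltW.
have BE x : B x -> eps < x -> rl_span s x.
  case=> [[]//|[|-> /=]]; last by rewrite ltxx.
  by rewrite As => /(mem_rl_span s01).
apply: (@sub_finite_set _ _ B).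
  apply: smallest_sub; last first.
    move=> x [Ax|->]; first by right; left.
    by left; split=> //; exact: rl_span1.
  split=> [x /B01|x y Bx By]; first by rewrite /= in_itv.
  rewrite /approx_mul; case: ifP => [lt_xy|_]; last by right; right.
  have x01 := B01 _ Bx; have y01 := B01 _ By.
  (* A product above [eps] has both factors above [eps], hence both in the span. *)
  left; split=> //; apply: rl_span_closed => //; apply: BE => //.
    exact: lt_le_trans (rl_mul_leQl x01 y01).
  exact: lt_le_trans (rl_mul_leQr x01 y01).
rewrite !finite_setU; split; first exact: finite_rl_span_gt.
by split; [rewrite As; exact: finite_seq | exact: finite_set1].
Qed.

(** Cleared of the denominator, which vanishes at [x = y = 0]. *)
Definition below_hamacher := forall x y, 0 <= x <= 1 -> 0 <= y <= 1 ->
  rl_mul L x y * (x + y - x * y) <= x * y.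

(** For positive values the Hamacher bound says that the reciprocal of a product is at least
    [1/x + 1/y - 1], so each further factor [a] adds at least [1/a - 1] to the reciprocal of the
    power. *)
Lemma rl_exp_below_hamacher a n : below_hamacher -> 0 < a <= 1 ->
  rl_exp a n * (a + n%:R * (1 - a)) <= a.
Proof.
move=> belowH /andP[a0 a1]; have a01 : 0 <= a <= 1 by rewrite ltW.
elim: n => [|n]; first by rewrite mul0r addr0 mul1r.
have x01 := rl_exp_itv n a01; have y01 := rl_exp_itv n.+1 a01.
have := belowH _ _ a01 x01; have := rl_mul_leQr a01 x01.
change (rl_mul L a (rl_exp a n)) with (rl_exp a n.+1); move: x01 y01.
move: (rl_exp a n) (rl_exp a n.+1) => x y /andP[x0 x1] /andP[y0 y1] yx Hy Hx.
rewrite -natr1 mulrDl mul1r addrA.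
move: (a + n%:R * (1 - a)) Hx => D Hx.
move: x0; rewrite le_eqVlt => /predU1P[x0|x0].
  have -> : y = 0 by apply/eqP; rewrite eq_le y0 x0 yx.
  by rewrite mul0r ltW.
(* The induction hypothesis [x * D <= a] bounds [x * (D + (1 - a))] by [a + x - a * x], the factor
   occurring in [Hy]. *)
rewrite -(ler_pM2l x0).
apply: le_trans (_ : y * (a + x - a * x) <= _); last by rewrite (mulrC x).
rewrite mulrCA ler_wpM2l //; lra.
Qed.

Lemma below_hamacher_archimedean eps : 0 < eps -> below_hamacher ->
  rl_archimedean eps.
Proof.
move=> eps0 belowH a /andP[a0 a1]; have a01 : 0 <= a <= 1 by rewrite a0 ltW.
have [a_le|a_gt] := leP a eps.
  by exists 1%N; rewrite /rl_exp /= rl_mul1.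
have a_gt0 : 0 < a := lt_trans eps0 a_gt.
have c0 : 0 < eps * (1 - a) by rewrite mulr_gt0 // subr_gt0.
(* This [n] makes [n * eps * (1 - a)] exceed 1, hence [eps * (a + n * (1 - a))] exceed [a]. *)
have [n n_gt] : exists n, (eps * (1 - a))^-1 < n%:R.
  by exists (Num.bound (eps * (1 - a))^-1); rewrite archi_boundP ?invr_ge0 ?ltW.
exists n.
have D0 : 0 < a + n%:R * (1 - a).
  by rewrite ltr_pwDl // mulr_ge0 ?ler0n ?subr_ge0 ?ltW.
rewrite -(ler_pM2r D0); apply: le_trans (rl_exp_below_hamacher _ belowH _) _.
  by rewrite a_gt0 ltW.
have : 1 < n%:R * (eps * (1 - a)) by rewrite -ltr_pdivrMr // mul1r.
have : 0 < eps * a by rewrite mulr_gt0.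
by move: (n%:R : R) => N; lra.
Qed.

End ResiduatedLattice.

(** Here [1 - (x + y - x * y) = (1 - x) * (1 - y)] is nonnegative. *)
Lemma product_below_hamacher (R : realType) :
  below_hamacher (product_structure R).
Proof.
move=> x y /andP[x0 x1] /andP[y0 y1]; rewrite /= /product_mul.
by rewrite ler_piMr ?mulr_ge0 //; nra.
Qed.

Lemma hamacher_below_hamacher (R : realType) :
  below_hamacher (hamacher_structure R).
Proof.
move=> x y /andP[x0 x1] y01 /=; move: x0.
rewrite le_eqVlt => /predU1P[<-|x0]; first by rewrite hamacher_mul0 !mul0r.
by have [d0 ->] := hamacher_mulE x0 y01; rewrite divfK ?gt_eqF.
Qed.

Theorem proposition3p2 (R : realType) (eps : R)
    (eps_gt0 : 0 < eps) (eps_lt1 : eps < 1)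
    (L : unit_residuated_lattice R)
    (hL : L = product_structure R \/ L = hamacher_structure R) :
  mul_locally_finite (approx_mul L eps).
Proof.
apply: approx_mul_locally_finite; first by rewrite ltW.
apply: below_hamacher_archimedean => //.
by case: hL => ->; [exact: product_below_hamacher | exact: hamacher_below_hamacher].
Qed.
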